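(* Let $b$ be a locally finite graph over a countable discrete set $X$. Let $m\geq 1$ be an integer and let $V, f\in C(X)$ be such that $\Delta^k f > 0$ on $X$ for all $0 \leq k \leq m-1$. Then for any $u\in C_c(X)$, there holds $$\begin{aligned} & \sum_{x\in X}V(x) |\Delta^m u(x)|^2 - \sum_{x\in X} \frac{\Delta^m(V\Delta^m f)(x)}{f(x)}\, u(x)^2\\ & = \sum_{k = 0}^{m-1}\sum_{x\in X}\frac{\Delta^{m-1-k}(V\Delta^m f)}{\Delta^{k+1} f}(x)\left|\Delta^{k+1} u - L(\Delta^k f)\, \Delta^k u\right|^2(x)\\ & \quad + 2\sum_{k = 0}^{m-1}\mathscr{R}\left(\frac{\Delta^{m-1-k}(V\Delta^m f)}{\Delta^kf},\, \Delta^k f,\, \Delta^k u\right), \end{aligned}$$ where in the term $k=m-1$ of the first sum on the right-hand side the quotient $\frac{V\Delta^m f}{\Delta^m f}$ is understood as $V$.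
   Context: A graph over a countable discrete set $X$ is a symmetric function $b:X\times X\to[0,\infty)$ vanishing on the diagonal; $x\sim y$ means $b(x,y)>0$; the graph is locally finite if every $x\in X$ has finitely many neighbors. $C(X)$ is the space of real functions on $X$ and $C_c(X)$ the finitely supported ones. The Laplacian is $\Delta u(x)=\sum_{y\sim x} b(x,y)[u(x)-u(y)]$, and $\Delta^k$ is its $k$-fold iterate ($\Delta^0=\mathrm{Id}$). For positive $g\in C(X)$, $L(g):=\frac{\Delta g}{g}$. For $W\in C(X)$, positive $g\in C(X)$ and $v\in C_c(X)$, $$\mathscr{R}(W,g,v):=\frac12\sum_{x,y\in X} b(x,y)\,W(x)\left(\sqrt{\frac{g(x)}{g(y)}}\,v(y)-\sqrt{\frac{g(y)}{g(x)}}\,v(x)\right)^2.$$ *)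

(* Defs.v *)
From mathcomp Require Import all_boot all_order all_algebra.
From mathcomp Require Import boolp classical_sets functions cardinality fsbigop.
From mathcomp Require Import reals.

Set Implicit Arguments.
Unset Strict Implicit.
Unset Printing Implicit Defensive.

Import Order.TTheory GRing.Theory Num.Theory.
Local Open Scope classical_set_scope.
Local Open Scope ring_scope.

Record graph (R : realType) (X : countType) := Graph {
  weight :> X -> X -> R;
  weight_ge0 : forall x y, 0 <= weight x y;
  weight_sym : forall x y, weight x y = weight y x;
  weight_diag : forall x, weight x x = 0
}.

Section GraphDefs.
Variables (R : realType) (X : countType).
Implicit Types (b : graph R X) (u v g W : X -> R).

Definition neighbors b (x : X) : set X := [set y | 0 < b x y].

Definition locally_finite b : Prop := forall x, finite_set (neighbors b x).

Definition finitely_supported u : Prop := finite_set [set x | u x != 0].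

(* [\sum_(i \in A) F i] is 0 by convention when F has infinite support on A.
   On a locally finite graph this convention is never used below: neighbors
   are finite in number, the Laplacian preserves finite support, and the
   summand of [remainder] has finite support whenever v does. *)

Definition laplacian b u : X -> R :=
  fun x => \sum_(y \in neighbors b x) b x y * (u x - u y).

Definition iter_laplacian b (k : nat) u : X -> R := iter k (laplacian b) u.

Definition L b g : X -> R := fun x => laplacian b g x / g x.

Definition remainder b W g v : R :=
  2^-1 * \sum_(p \in [set: X * X])
    b p.1 p.2 * W p.1 *
    (Num.sqrt (g p.1 / g p.2) * v p.2 - Num.sqrt (g p.2 / g p.1) * v p.1) ^+ 2.

(* The quotient (Delta^{m-1-k} (V Delta^m f)) / (Delta^{k+1} f), read as V for
   k = m - 1, where Delta^m f is allowed to vanish. *)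
Definition square_coef b (m : nat) (V f : X -> R) (k : nat) : X -> R :=
  fun x =>
    if k == (m - 1)%N then V x
    else iter_laplacian b (m - 1 - k) (V \* iter_laplacian b m f) x
         / iter_laplacian b k.+1 f x.

End GraphDefs.

(* Main.v *)
Require Import Defs.
From mathcomp Require Import all_boot all_order all_algebra.
From mathcomp Require Import boolp classical_sets functions cardinality fsbigop.
From mathcomp Require Import reals ring.

Import Order.TTheory GRing.Theory Num.Theory.
Local Open Scope classical_set_scope.
Local Open Scope ring_scope.

(* Write w_k = Delta^(m-k) (V Delta^m f) and
   S_k = sum_x w_k / (Delta^k f) * (Delta^k u)^2, with S_m read as
   sum_x V (Delta^m u)^2.  The left-hand side is S_m - S_0, and the k-th term
   of the right-hand side is S_(k+1) - S_k.  The latter is a first-order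
   identity for g = Delta^k f, v = Delta^k u and w = w_(k+1): expanding both
   squares, every term is a sum of b(x,y) times a function of (x,y) over a
   finite set containing the support of v and its neighbours, and the two sides
   agree after exchanging x and y in the term b(x,y) w(x) v(y)^2 / g(y). *)

Lemma fsum_setT_seq {R : realType} {T : choiceType} {s : seq T} (F : T -> R) :
  uniq s -> (forall x, F x != 0 -> x \in s) ->
  \sum_(x \in [set: T]) F x = \sum_(x <- s) F x.
Proof.
move=> us sF; rewrite [RHS]fsbig_seq //; symmetry; apply: fsbig_widen => // x [_ /= xs].
by apply: contra_notP xs => /eqP/sF.
Qed.

Lemma weight_nbr {R : realType} {X : countType} {b : graph R X} {x y : X} :
  b x y != 0 -> neighbors b x y.
Proof. by move=> bxy; rewrite /neighbors /= lt_neqAle eq_sym bxy weight_ge0. Qed.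

Lemma laplacian_seq {R : realType} {X : countType} {b : graph R X} {s : seq X}
    (h : X -> R) {x : X} :
  uniq s -> neighbors b x `<=` [set` s] ->
  laplacian b h x = \sum_(y <- s) b x y * (h x - h y).
Proof.
move=> us sx; rewrite /laplacian [RHS]fsbig_seq //; apply: fsbig_widen => // y [_ /= nxy].
by have [->|/weight_nbr//] := eqVneq (b x y) 0; rewrite mul0r.
Qed.

(** One list [s] serves every sum attached to [v], so that these sums can be split, merged and
    exchanged over a common range. *)
Lemma finite_closed_neighborhood {R : realType} {X : countType} {b : graph R X}
    {v : X -> R} :
  locally_finite b -> finitely_supported v ->
  exists2 s : seq X, uniq s &
    forall x, v x != 0 -> x \in s /\ neighbors b x `<=` [set` s].
Proof.
move=> hb fv.
have /finite_seqP[s sE] : finite_set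
    ([set x | v x != 0] `|` \bigcup_(x in [set x | v x != 0]) neighbors b x).
  by rewrite finite_setU; split => //; apply: bigcup_finite => // x _; exact: hb.
have memE x : [set` s] x -> [set` undup s] x by rewrite /= mem_undup.
exists (undup s); first exact: undup_uniq.
by move=> x vx; split=> [|y xy]; apply: memE; rewrite -sE; [left | right; exists x].
Qed.

(** A point outside [s] is neither in the support of [v] nor, by symmetry of [b], adjacent to it, so
    every difference in the Laplacian is [0 - 0]. *)
Lemma laplacian_support {R : realType} {X : countType} {b : graph R X}
    {v : X -> R} {s : seq X} :
  (forall x, v x != 0 -> x \in s /\ neighbors b x `<=` [set` s]) ->
  forall x, laplacian b v x != 0 -> x \in s.
Proof.
move=> hs x; apply: contraNT => xs; apply/eqP.
have v0 z : neighbors b z x \/ z = x -> v z = 0.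
  move=> zx; apply/eqP; apply: contraT => /hs[zs ns].
  by case: zx xs => [/ns/= ->|<-]; rewrite ?zs.
rewrite /laplacian; apply: fsbig1 => y xy.
rewrite (v0 x); last by right.
by rewrite (v0 y) ?subrr ?mulr0//; left; move: xy; rewrite /neighbors /= weight_sym.
Qed.

Lemma finitely_supported_laplacian {R : realType} {X : countType}
    {b : graph R X} {v : X -> R} :
  locally_finite b -> finitely_supported v -> finitely_supported (laplacian b v).
Proof.
move=> hb /(finite_closed_neighborhood hb)[s _ hs].
apply: (@sub_finite_set _ _ [set` s]); last by apply/finite_seqP; exists s.
by move=> x; exact: laplacian_support.
Qed.

Lemma finitely_supported_iter_laplacian {R : realType} {X : countType}
    {b : graph R X} {v : X -> R} (k : nat) :
  locally_finite b -> finitely_supported v ->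
  finitely_supported (iter_laplacian b k v).
Proof. by move=> hb fv; elim: k => // k; exact: finitely_supported_laplacian. Qed.

(** The two square roots are inverse to each other, which removes them from the cross term. *)
Lemma ground_state_square {R : realType} {p q : R} (s t : R) : 0 < p -> 0 < q ->
  (Num.sqrt (p / q) * t - Num.sqrt (q / p) * s) ^+ 2
  = p / q * t ^+ 2 + q / p * s ^+ 2 - 2 * (s * t).
Proof.
move=> p0 q0; have pq0 : 0 <= p / q by rewrite ltW ?divr_gt0.
have qp0 : 0 <= q / p by rewrite ltW ?divr_gt0.
have E : Num.sqrt (p / q) * Num.sqrt (q / p) = 1.
  by rewrite -sqrtrM // mulrA divfK ?divff ?sqrtr1 ?gt_eqF.
rewrite sqrrB !exprMn !sqr_sqrtr // [X in _ - X *+ 2]mulrACA E.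
ring.
Qed.

(** A nonzero summand needs an edge with an endpoint in the support of [v]; the other endpoint is
    then a neighbour of it, so both lie in [s]. *)
Lemma remainder_seq {R : realType} {X : countType} {b : graph R X}
    (W g : X -> R) {v : X -> R} {s : seq X} :
  uniq s -> (forall x, v x != 0 -> x \in s /\ neighbors b x `<=` [set` s]) ->
  remainder b W g v = 2^-1 * \sum_(x <- s) \sum_(y <- s) b x y * W x *
    (Num.sqrt (g x / g y) * v y - Num.sqrt (g y / g x) * v x) ^+ 2.
Proof.
move=> us hs; rewrite /remainder; congr (_ * _).
rewrite (@fsum_setT_seq _ _ [seq (x, y) | x <- s, y <- s]); first last.
- move=> [x y] /= Fxy.
  have bxy : b x y != 0 by apply: contraNneq Fxy => ->; rewrite !mul0r.
  apply/allpairsP; exists (x, y) => /=.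
  have [vx|/hs[xs nx]] := eqVneq (v x) 0; last first.
    by split=> //; exact: nx (weight_nbr bxy).
  have [vy|/hs[ys ny]] := eqVneq (v y) 0.
    by move: Fxy; rewrite vx vy !mulr0 subrr expr0n mulr0 eqxx.
  by split=> //; apply: ny; apply: weight_nbr; rewrite weight_sym.
- by apply: allpairs_uniq => // -[? ?] [? ?].
by rewrite big_allpairs.
Qed.

(* [w = a * Delta g] is a hypothesis rather than a definition
   of [a] so that [Delta g] may vanish. *)
Lemma rellich_identity_step {R : realType} {X : countType} {b : graph R X}
    {a w g v : X -> R} :
  locally_finite b -> finitely_supported v -> (forall x, 0 < g x) ->
  (forall x, a x * laplacian b g x = w x) ->
  \sum_(x \in [set: X]) a x * `|laplacian b v x| ^+ 2
  - \sum_(x \in [set: X]) laplacian b w x / g x * v x ^+ 2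
  = \sum_(x \in [set: X]) a x * `|laplacian b v x - L b g x * v x| ^+ 2
  + 2 * remainder b (fun x => w x / g x) g v.
Proof.
move=> hb fv g0 aw; have [s us hs] := finite_closed_neighborhood hb fv.
have gN0 x : g x != 0 by rewrite gt_eqF.
have vs x : v x != 0 -> x \in s by case/hs.
have lvs := laplacian_support hs.
rewrite !(@fsum_setT_seq _ _ s) //; first last.
- move=> x; apply: contraNT => /(contraNN (lvs x))/negbNE/eqP->.
  by rewrite normr0 expr0n mulr0.
- move=> x; apply: contraNT => /(contraNN (vs x))/negbNE/eqP->.
  by rewrite expr0n mulr0.
- move=> x; apply: contraNT => xs.
  have /negbNE/eqP-> := contraNN (vs x) xs.
  have /negbNE/eqP-> := contraNN (lvs x) xs.
  by rewrite mulr0 subrr normr0 expr0n mulr0.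
rewrite (remainder_seq _ _ us hs) mulrA divff ?pnatr_eq0 // mul1r.
apply/eqP; rewrite [X in _ == X]addrC -subr_eq; apply/eqP.
(* [v x * Delta h x] only sees neighbours of the support of [v], hence is a
   sum over [s] for arbitrary [h]. *)
have vlap h x : v x * laplacian b h x = \sum_(y <- s) v x * (b x y * (h x - h y)).
  rewrite -mulr_sumr; have [->|/hs[_ nx]] := eqVneq (v x) 0; first by rewrite !mul0r.
  by rewrite (laplacian_seq _ us nx).
(* On the edge [(x, y)] the remainder contributes [P x y + Q x y], the other three sums
   [P x y + Q y x]; only [Q] has to be symmetrized. *)
pose P x y := w x * g y / g x ^+ 2 * v x ^+ 2 - 2 * w x * v x * v y / g x.
pose Q x y := w x * v y ^+ 2 / g y.
transitivity (\sum_(x <- s) \sum_(y <- s) (b x y * P x y + b x y * Q y x)).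
  rewrite -!sumrN -!big_split /=; apply: eq_bigr => x _.
  (* The two squares of [laplacian b v x] cancel; what is left of [a x] occurs only in
     [a x * laplacian b g x], that is [w x]. *)
  transitivity (2 * w x / g x * (v x * laplacian b v x)
      - w x / g x ^+ 2 * v x * (v x * laplacian b g x)
      - v x / g x * (v x * laplacian b w x)).
    rewrite !real_normK ?num_real // /L -(aw x); field; exact: gN0.
  rewrite !vlap !mulr_sumr -!sumrN -!big_split /=; apply: eq_bigr => y _.
  rewrite /P /Q; field; exact: gN0.
transitivity (\sum_(x <- s) \sum_(y <- s) (b x y * P x y + b x y * Q x y)).
  under eq_bigr do rewrite big_split /=.
  under [RHS]eq_bigr do rewrite big_split /=.
  rewrite !big_split /=; congr (_ + _).
  rewrite exchange_big /=; apply: eq_bigr => y _; apply: eq_bigr => x _.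
  by rewrite weight_sym.
apply: eq_bigr => x _; apply: eq_bigr => y _.
rewrite ground_state_square // /P /Q; field; by rewrite !gN0.
Qed.

Theorem theorem2p3 (R : realType) (X : countType) (b : graph R X)
    (hb : locally_finite b) (m : nat) (hm : (1 <= m)%N) (V f : X -> R)
    (hf : forall k : nat, (k <= m - 1)%N ->
            forall x : X, 0 < iter_laplacian b k f x)
    (u : X -> R) (hu : finitely_supported u) :
  \sum_(x \in [set: X]) V x * `|iter_laplacian b m u x| ^+ 2
  - \sum_(x \in [set: X])
      iter_laplacian b m (V \* iter_laplacian b m f) x / f x * u x ^+ 2
  = \sum_(k < m) \sum_(x \in [set: X])
      square_coef b m V f k x
      * `|iter_laplacian b k.+1 u x
          - L b (iter_laplacian b k f) x * iter_laplacian b k u x| ^+ 2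
  + 2 * \sum_(k < m)
      remainder b
        (fun x => iter_laplacian b (m - 1 - k) (V \* iter_laplacian b m f) x
                  / iter_laplacian b k f x)
        (iter_laplacian b k f) (iter_laplacian b k u).
Proof.
pose w k := iter_laplacian b (m - k) (V \* iter_laplacian b m f).
pose a k x := if k == m then V x else w k x / iter_laplacian b k f x.
pose S k := \sum_(x \in [set: X]) a k x * `|iter_laplacian b k u x| ^+ 2.
have aE k : (k < m)%N -> square_coef b m V f k = a k.+1.
  move=> km; apply/funext => x; rewrite /square_coef /a /w -subnDA add1n.
  by rewrite -(eqn_add2r 1) subnK // addn1.
(* At [k.+1 = m] both sides are [V * Delta^m f], without division; below that, [k.+1 <= m - 1] and
   [hf] makes the denominator positive. *)
have aw k : (k < m)%N -> forall x,
    a k.+1 x * iter_laplacian b k.+1 f x = w k.+1 x.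
  move=> km x; rewrite /a /w; case: eqVneq => [->|km']; first by rewrite subnn.
  have km1 : (k < m - 1)%N by rewrite ltn_subRL add1n ltn_neqAle km'.
  by rewrite divfK // gt_eqF // hf.
(* As [m >= 1], index 0 falls in the quotient case of [a]. *)
have S0 : \sum_(x \in [set: X])
      iter_laplacian b m (V \* iter_laplacian b m f) x / f x * u x ^+ 2 = S 0%N.
  apply: eq_fsbigr => x _; rewrite /a /w ltn_eqF // subn0.
  by rewrite real_normK ?num_real.
have -> : \sum_(x \in [set: X]) V x * `|iter_laplacian b m u x| ^+ 2 = S m.
  by apply: eq_fsbigr => x _; rewrite /a eqxx.
rewrite S0 -telescope_sumr // big_mkord mulr_sumr -big_split /=.
apply: eq_bigr => -[k km] _ /=; rewrite aE // -subnDA add1n -/(w k.+1).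
rewrite -(@rellich_identity_step _ _ b (a k.+1)) //; last 3 first.
- exact: finitely_supported_iter_laplacian.
- by apply: hf; rewrite leq_subRL ?add1n.
- exact: aw.
congr (_ - _); apply: eq_fsbigr => x _.
rewrite /a ltn_eqF // real_normK ?num_real //.
congr (_ / _ * _).
(* [m - k = (m - k.+1).+1] because [k < m], so the Laplacian of [w k.+1] is [w k]. *)
by rewrite /w subnS -[in LHS](prednK (_ : 0 < m - k)%N) // subn_gt0.
Qed.
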